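(* Let $\phi:V\to W$ be a linear map of finite-dimensional real vector spaces. The map $\mathcal F\phi:\mathrm{Dir}(V)\to\mathrm{Dir}(W)$ is $\mathrm{Bil}(W)$-equivariant, i.e. $\mathcal F\phi(\tau_{\phi^*B}(L))=\tau_B(\mathcal F\phi(L))$ for all $L\in\mathrm{Dir}(V)$ and $B\in\mathrm{Bil}(W)$.
   Context: $\mathrm{Dir}(V)$ is the set of Dirac structures on $V$: subspaces $L\subset V\oplus V^*$ maximally isotropic for the pairing $\langle (x,\omega),(y,\mu)\rangle=\frac12(\omega(y)+\mu(x))$. $\mathcal F\phi(L)=\{(\phi(x),\eta): x\in V,\eta\in W^*,(x,\phi^*\eta)\in L\}$, which is a Dirac structure on $W$. $\mathrm{Bil}(W)$ is the additive group of skew-symmetric bilinear forms on $W$; it acts on $\mathrm{Dir}(W)$ by gauge transformations $\tau_B(L)=\{(x,\eta+B(x,\cdot)):(x,\eta)\in L\}$, and on $\mathrm{Dir}(V)$ via $B\mapsto\tau_{\phi^*B}$, where $\phi^*B$ is the pull-back form on $V$. *)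

(* Defs.v *)
From HB Require Import structures.
From mathcomp Require Import all_boot all_order all_algebra.
From mathcomp Require Import boolp reals.

Set Implicit Arguments.
Unset Strict Implicit.
Unset Printing Implicit Defensive.

Import Order.TTheory GRing.Theory Num.Theory.
Local Open Scope ring_scope.

(* [Bil(V)]: MathComp's bundled skew-symmetric bilinear forms [V -> V -> R]. *)
Definition Bil (R : realType) (V : vectType R) := {skew_symmetric V}.

Section BilGroup.
Variables (R : realType) (V : vectType R).
Implicit Types B C : Bil V.

Lemma Bil_skew B x y : B x y = - B y x.
Proof. by rewrite hermC /= expr1 mulN1r. Qed.

Lemma Bil_ext B C : (forall x y, B x y = C x y) -> B = C.
Proof.
move=> eqBC; have: (B : V -> V -> R) = C by apply/funext => x; apply/funext => y.
case: B {eqBC} => f [[a1 a2 a3 a4] [a5]]; case: C => g [[b1 b2 b3 b4] [b5]] /= e.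
by subst g; congr (Hermitian.Pack (Hermitian.Class _ _)); f_equal;
  apply: Prop_irrelevance.
Qed.

Section Mk.
Variables (f : V -> V -> R).
Hypothesis f_linear : forall y a x x', f (a *: x + x') y = a * f x y + f x' y.
Hypothesis f_skew : forall x y, f x y = - f y x.

Let f_bilinear :
  bilinear_for (GRing.Scale.Law.clone _ _ *%R _)
               (GRing.Scale.Law.clone _ _ (idfun \; *%R) _) f.
Proof.
split=> [y|x] a u v /=; first exact: f_linear.
by rewrite f_skew f_linear opprD -mulrN -!f_skew.
Qed.

Let f_hermitian x y : f x y = (-1) ^+ true * idfun (f y x).
Proof. by rewrite f_skew expr1 mulN1r. Qed.

Definition MkBil : Bil V :=
  HB.pack_for {skew_symmetric V} f
    (bilinear_isBilinear.Build R V V R _ _ f f_bilinear)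
    (isHermitianSesquilinear.Build R V true idfun f f_hermitian).
End Mk.

(* The additive group structure is the pointwise one. *)
Fact zeroB_linear (y : V) a (x x' : V) : 0 = a * 0 + 0 :> R.
Proof. by rewrite mulr0 addr0. Qed.
Fact zeroB_skew (x y : V) : 0 = - 0 :> R.
Proof. by rewrite oppr0. Qed.
Definition zeroB : Bil V := MkBil zeroB_linear zeroB_skew.

Fact oppB_linear B y a x x' : - B (a *: x + x') y = a * - B x y + - B x' y.
Proof. by rewrite linearPl opprD mulrN. Qed.
Fact oppB_skew B x y : - B x y = - - B y x.
Proof. by rewrite [in LHS]Bil_skew. Qed.
Definition oppB B : Bil V := MkBil (oppB_linear B) (oppB_skew B).

Fact addB_linear B C y a x x' :
  B (a *: x + x') y + C (a *: x + x') y = a * (B x y + C x y) + (B x' y + C x' y).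
Proof. by rewrite !linearPl mulrDr addrACA. Qed.
Fact addB_skew B C x y : B x y + C x y = - (B y x + C y x).
Proof. by rewrite [B x y]Bil_skew [C x y]Bil_skew opprD. Qed.
Definition addB B C : Bil V := MkBil (addB_linear B C) (addB_skew B C).

Fact addBA : associative addB.
Proof. by move=> B C D; apply: Bil_ext => x y; apply: addrA. Qed.
Fact addBC : commutative addB.
Proof. by move=> B C; apply: Bil_ext => x y; apply: addrC. Qed.
Fact add0B : left_id zeroB addB.
Proof. by move=> B; apply: Bil_ext => x y; apply: add0r. Qed.
Fact addNB : left_inverse zeroB oppB addB.
Proof. by move=> B; apply: Bil_ext => x y; apply: addNr. Qed.

HB.instance Definition _ := gen_eqMixin (Bil V).
HB.instance Definition _ := gen_choiceMixin (Bil V).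
HB.instance Definition _ :=
  GRing.isZmodule.Build (Bil V) addBA addBC add0B addNB.

Lemma Bil0E x y : (0 : Bil V) x y = 0.
Proof. by []. Qed.

Lemma BilDE B C x y : (B + C) x y = B x y + C x y.
Proof. by []. Qed.

(* [flat B x] is the covector [B(x, .)]. *)
Definition flat B (x : V) : 'Hom(V, R^o) := linfun (B x : V -> R^o).

Lemma flatE B x y : flat B x y = B x y.
Proof.
pose f : {linear V -> R^o} := HB.pack (B x : V -> R^o)
  (GRing.isLinear.Build R V R^o *:%R (B x : V -> R^o) (linearPr B x)).
exact: (lfunE f).
Qed.
End BilGroup.

Section Pullback.
Variables (R : realType) (V W : vectType R) (phi : 'Hom(V, W)) (B : Bil W).

Fact pullback_linear y a x x' :
  B (phi (a *: x + x')) (phi y) = a * B (phi x) (phi y) + B (phi x') (phi y).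
Proof. by rewrite linearP linearPl. Qed.
Fact pullback_skew x y : B (phi x) (phi y) = - B (phi y) (phi x).
Proof. exact: Bil_skew. Qed.

Definition pullback : Bil V :=
  @MkBil R V (fun x y => B (phi x) (phi y)) pullback_linear pullback_skew.

Lemma pullbackE x y : pullback x y = B (phi x) (phi y).
Proof. by []. Qed.
End Pullback.

Lemma pullbackD (R : realType) (V W : vectType R) (phi : 'Hom(V, W)) :
  {morph pullback phi : B C / B + C}.
Proof. by move=> B C; apply: Bil_ext. Qed.

Section Dirac.
Variables (R : realType) (V : vectType R).
Local Notation VV := (V * 'Hom(V, R^o))%type.
Implicit Types (p q : VV) (L M : {vspace VV}).

(* A point of [V + V^*] is a pair [p] with [p.1] a vector and [p.2] a covector. *)
Definition pairing p q : R := 2^-1 * (p.2 q.1 + q.2 p.1).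

Definition isotropic L : Prop := {in L &, forall p q, pairing p q = 0}.

Definition max_isotropic L : Prop :=
  isotropic L /\ forall M, isotropic M -> (L <= M)%VS -> M = L.

Record Dir := MkDir {
  dirac_space :> {vspace VV};
  dirac_max_isotropic : max_isotropic dirac_space }.

Lemma Dir_inj (L M : Dir) : (dirac_space L =i dirac_space M) -> L = M.
Proof.
case: L M => [L HL] [M HM] /= /vspaceP eLM.
by subst M; congr MkDir; apply: Prop_irrelevance.
Qed.

Lemma pairing_eq0 p q : pairing p q = 0 <-> p.2 q.1 + q.2 p.1 = 0.
Proof.
rewrite /pairing; split=> [/eqP|->]; last by rewrite mulr0.
by rewrite mulf_eq0 invr_eq0 pnatr_eq0 /= => /eqP.
Qed.

Lemma pairingC p q : pairing p q = pairing q p.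
Proof. by rewrite /pairing addrC. Qed.

Lemma pairingPr p a q q' : pairing p (a *: q + q') = a * pairing p q + pairing p q'.
Proof.
rewrite /pairing /= linearP add_lfunE scale_lfunE /=.
rewrite mulrCA -mulrDr; congr (_ * _).
by rewrite mulrDr addrACA.
Qed.

Lemma pairingPl q a p p' : pairing (a *: p + p') q = a * pairing p q + pairing p' q.
Proof. by rewrite ![pairing _ q]pairingC pairingPr. Qed.

Lemma self_orthogonal_max L : isotropic L ->
  (forall p, {in L, forall q, pairing p q = 0} -> p \in L) -> max_isotropic L.
Proof.
move=> isoL orthL; split=> // M isoM /subvP LM; apply/vspaceP => p.
apply/idP/idP=> [Mp|]; last exact: LM.
by apply: orthL => q Lq; apply: isoM => //; apply: LM.
Qed.

Lemma separation (T : vectType R) (U : {vspace T}) (u : T) : u \notin U ->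
  exists2 f : 'Hom(T, R^o), f u != 0 & {in U, forall v, f v = 0}.
Proof.
move=> nUu; pose w := u - projv U u.
have [i wi] : exists i, coord (vbasis {:T}) i w != 0.
  apply/existsP; apply: contraNT nUu; rewrite negb_exists => /forallP w0.
  suff /eqP : w = 0 by rewrite subr_eq0 => /eqP ->; apply: memv_proj.
  rewrite (coord_vbasis (memvf w)) big1 // => i _.
  by have:= w0 i; rewrite negbK => /eqP ->; rewrite scale0r.
exists (linfun (coord (vbasis {:T}) i : T -> R^o) \o (\1 - projv U))%VF.
  by rewrite comp_lfunE lfunE /= add_lfunE opp_lfunE id_lfunE.
move=> v Uv; rewrite comp_lfunE add_lfunE opp_lfunE id_lfunE projv_id //.
by rewrite subrr linear0.
Qed.

(* The pairing identifies [V + V^*] with its own dual. *)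
Lemma functional_pairing (f : 'Hom(VV, R^o)) :
  exists q, forall p, f p = p.2 q.1 + q.2 p.1.
Proof.
pose b := vbasis {:V}; pose e i := linfun (coord b i : V -> R^o).
have inl_linear : linear (fun x : V => f (x, 0)).
  move=> a x y; rewrite -linearP; congr (f _).
  by congr (_, _); rewrite /= scaler0 addr0.
pose g : {linear V -> R^o} := HB.pack (fun x : V => f (x, 0) : R^o)
  (GRing.isLinear.Build R V R^o *:%R (fun x : V => f (x, 0)) inl_linear).
exists (\sum_(i < \dim {:V}) (f (0, e i) : R) *: b`_i, linfun g) => -[x w] /=.
have -> : (x, w) = (0, w) + (x, 0).
  by congr (_, _); rewrite /= ?add0r ?addr0.
rewrite linearD (lfunE g) /=; congr (_ + _).
have wE : w = \sum_(i < \dim {:V}) (w b`_i : R) *: e i.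
  apply/lfunP => y; rewrite sum_lfunE [in LHS](coord_vbasis (memvf y)) linear_sum.
  by apply: eq_bigr => i _; rewrite linearZ scale_lfunE lfunE /=; apply: mulrC.
have inr_add : {morph (fun n : 'Hom(V, R^o) => (0, n) : VV) : m n / m + n}.
  by move=> m n; congr (_, _); rewrite /= addr0.
rewrite {1}wE (big_morph _ inr_add (erefl (0 : VV))).
rewrite !linear_sum; apply: eq_bigr => i _.
have -> : (0, w b`_i *: e i) = (w b`_i : R) *: ((0, e i) : VV).
  by congr (_, _); rewrite /= scaler0.
by rewrite !linearZ /=; apply: mulrC.
Qed.

Lemma dirac_mem L p : max_isotropic L ->
  {in L, forall q, pairing p q = 0} -> pairing p p = 0 -> p \in L.
Proof.
move=> [isoL maxL] orthp pp; rewrite -(maxL (L + <[p]>)%VS) ?addvSl //.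
  by rewrite (subvP (addvSr _ _)) ?memv_line.
move=> u v /memv_addP[q Lq [_ /vlineP[a ->] ->]].
move=> /memv_addP[q' Lq' [_ /vlineP[a' ->] ->]].
rewrite [q + _]addrC [q' + _]addrC pairingPl !pairingPr pp.
by rewrite [pairing q p]pairingC !orthp // (isoL q q') // !(mulr0, addr0).
Qed.

Lemma dirac_orthogonal L p : max_isotropic L ->
  {in L, forall q, pairing p q = 0} -> p \in L.
Proof.
case: p => y m dL orthp.
pose E := (linfun (fst : VV -> V) @: L)%VS.
have annE (n : 'Hom(V, R^o)) : {in E, forall x, n x = 0} -> (0, n) \in L.
  move=> nE; apply: dirac_mem => //= [q Lq|]; apply/pairing_eq0; rewrite /= !linear0 addr0 //.
  by apply: nE; apply/memv_imgP; exists q; rewrite ?lfunE.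
have: y \in E.
  apply: contraT => /separation[n ny nE]; case/eqP: ny.
  have /pairing_eq0 := orthp _ (annE _ nE); rewrite /= linear0 add0r; exact.
case/memv_imgP => -[y' m'] Lp'; rewrite lfunE /= => yy'; subst y'.
have -> : (y, m) = (0, m - m') + (y, m').
  by congr (_, _); rewrite /= ?add0r ?subrK.
rewrite memvD //; apply: annE => _ /memv_imgP[q Lq ->].
rewrite add_lfunE opp_lfunE lfunE /=.
have /pairing_eq0 /= := orthp _ Lq; have /pairing_eq0 /= := dL.1 _ _ Lp' Lq.
move=> /eqP; rewrite addr_eq0 => /eqP h1 /eqP; rewrite addr_eq0 => /eqP h2.
by rewrite h1 h2 subrr.
Qed.
End Dirac.

Section Gauge.
Variables (R : realType) (V : vectType R).
Local Notation VV := (V * 'Hom(V, R^o))%type.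
Implicit Types (B C : Bil V).

(* [gauge_space B L = {(x, eta + B(x, .)) : (x, eta) in L}], see [mem_gauge_space]. *)
Definition shear B (p : VV) : VV := (p.1, p.2 + flat B p.1).

Fact shear_linear B : linear (shear B).
Proof.
move=> a p q; congr (_, _); apply/lfunP => z /=.
rewrite !(add_lfunE, scale_lfunE, flatE) linearPl scalerDr addrACA //.
Qed.
HB.instance Definition _ B := GRing.isLinear.Build R VV VV *:%R (shear B) (shear_linear B).

Definition gauge_space B (L : {vspace VV}) : {vspace VV} := (linfun (shear B) @: L)%VS.

Lemma mem_gauge_space B L (x : V) (w : 'Hom(V, R^o)) :
  (x, w) \in gauge_space B L <->
  exists2 eta, (x, eta) \in L & w = eta + flat B x.
Proof.
split=> [/memv_imgP[[x' eta] Lp]|[eta Lp ->]].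
  by rewrite lfunE => -[-> ->]; exists eta.
by apply/memv_imgP; exists (x, eta); rewrite ?lfunE.
Qed.

Lemma pairing_shear B p q : pairing (shear B p) (shear B q) = pairing p q.
Proof.
rewrite /pairing /= !add_lfunE !flatE [B q.1 _]Bil_skew.
by rewrite addrACA subrr addr0.
Qed.

Fact gauge_max_isotropic B (L : Dir V) : max_isotropic (gauge_space B L).
Proof.
have dL := dirac_max_isotropic L; apply: self_orthogonal_max.
  move=> u v /memv_imgP[p Lp ->] /memv_imgP[q Lq ->].
  by rewrite !lfunE /= pairing_shear dL.1.
move=> [y m] orthp.
have e : (y, m) = shear B (y, m - flat B y) by rewrite /shear /= subrK.
rewrite e -[shear B _](lfunE (shear B)) memv_img //.
apply: dirac_orthogonal => // q Lq; rewrite -(pairing_shear B) -e.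
by apply: orthp; rewrite -[shear B _](lfunE (shear B)) memv_img.
Qed.

Definition gauge B (L : Dir V) : Dir V := MkDir (gauge_max_isotropic B L).

Lemma gauge0 L : gauge 0 L = L.
Proof.
have f0 x : flat (0 : Bil V) x = 0 by apply/lfunP => z; rewrite flatE.
apply: Dir_inj => -[x w]; apply/idP/idP.
  by move/mem_gauge_space => [eta Leta ->]; rewrite f0 addr0.
by move=> Lw; apply/mem_gauge_space; exists w; rewrite ?f0 ?addr0.
Qed.

Lemma gaugeD B C L : gauge (B + C) L = gauge B (gauge C L).
Proof.
have fD x : flat (B + C) x = flat C x + flat B x.
  by apply/lfunP => z; rewrite add_lfunE !flatE BilDE addrC.
apply: Dir_inj => -[x w]; apply/idP/idP.
  move/mem_gauge_space => [eta Leta ->]; apply/mem_gauge_space.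
  exists (eta + flat C x); last by rewrite fD addrA.
  by apply/mem_gauge_space; exists eta.
move/mem_gauge_space => [_ /mem_gauge_space[eta Leta ->] ->].
by apply/mem_gauge_space; exists eta; rewrite // fD addrA.
Qed.
End Gauge.

Section Forward.
Variables (R : realType) (V W : vectType R) (phi : 'Hom(V, W)).
Local Notation VV := (V * 'Hom(V, R^o))%type.
Local Notation WW := (W * 'Hom(W, R^o))%type.
Local Notation VW := (V * 'Hom(W, R^o))%type.

(* [forward_space L = {(phi x, eta) : (x, phi^* eta) in L}], where
   [phi^* eta = eta \o phi]: preimage of [L] under [(x, eta) |-> (x, phi^* eta)],
   then image under [(x, eta) |-> (phi x, eta)]; see [mem_forward_space]. *)
Definition pull_covector (p : VW) : VV := (p.1, (p.2 \o phi)%VF).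
Definition push_vector (p : VW) : WW := (phi p.1, p.2).

Fact pull_covector_linear : linear pull_covector.
Proof. by move=> a p q; congr (_, _); rewrite /= comp_lfunDl comp_lfunZl. Qed.
HB.instance Definition _ :=
  GRing.isLinear.Build R VW VV *:%R pull_covector pull_covector_linear.

Fact push_vector_linear : linear push_vector.
Proof. by move=> a p q; congr (_, _); rewrite /= linearP. Qed.
HB.instance Definition _ :=
  GRing.isLinear.Build R VW WW *:%R push_vector push_vector_linear.

Definition forward_space (L : {vspace VV}) : {vspace WW} :=
  (linfun push_vector @: (linfun pull_covector @^-1: L))%VS.

Lemma mem_forward_space L (y : W) (eta : 'Hom(W, R^o)) :
  (y, eta) \in forward_space L <->
  exists2 x, y = phi x & (x, (eta \o phi)%VF) \in L.
Proof.
split=> [/memv_imgP[[x eta']]|[x -> Lx]].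
  by rewrite -memv_preim !lfunE /= => Lx [-> ->]; exists x.
by apply/memv_imgP; exists (x, eta); rewrite -?memv_preim !lfunE.
Qed.

Fact forward_max_isotropic (L : Dir V) : max_isotropic (forward_space L).
Proof.
have dL := dirac_max_isotropic L; apply: self_orthogonal_max.
  move=> [u m] [v n] /mem_forward_space[x -> Lx] /mem_forward_space[y -> Ly].
  apply/pairing_eq0; have /pairing_eq0 /= := dL.1 _ _ Lx Ly.
  by rewrite !comp_lfunE.
move=> [y m] orthp.
have [x0 _ yE] : exists2 x0, x0 \in fullv & y = phi x0.
  apply/memv_imgP; apply: contraT => /separation[n ny nphi]; case/eqP: ny.
  have Fn : (0, n) \in forward_space L.
    apply/mem_forward_space; exists 0; rewrite ?linear0 //.
    suff -> : (n \o phi)%VF = 0 by apply: mem0v.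
    by apply/lfunP => x; rewrite comp_lfunE zero_lfunE nphi // memv_img ?memvf.
  by have /pairing_eq0 /= := orthp _ Fn; rewrite linear0 add0r.
subst y; pose inl := linfun (fun x : V => (x, 0) : VV).
have inl_linear : linear (fun x : V => (x, 0) : VV).
  by move=> a x y; congr (_, _); rewrite /= scaler0 addr0.
have inlE x : inl x = (x, 0).
  pose g : {linear V -> VV} := HB.pack (fun x : V => (x, 0) : VV)
    (GRing.isLinear.Build R V VV *:%R (fun x : V => (x, 0) : VV) inl_linear).
  exact: (lfunE g).
have : (x0, (m \o phi)%VF) \in (dirac_space L + inl @: lker phi)%VS.
  apply: contraT => /separation[f fp f0]; case/eqP: fp.
  have [[x1 w1] fE] := functional_pairing f.
  have L1 : (x1, w1) \in dirac_space L.
    apply: dirac_orthogonal => // q Lq; rewrite pairingC; apply/pairing_eq0.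
    by rewrite -fE f0 // (subvP (addvSl _ _)).
  have w1ker x : phi x = 0 -> w1 x = 0.
    move=> phix; have := f0 (inl x); rewrite inlE fE /= zero_lfunE add0r; apply.
    rewrite -inlE (subvP (addvSr _ _)) // memv_img // memv_ker; exact/eqP.
  have w1E : (w1 \o phi^-1 \o phi)%VF = w1.
    apply/lfunP => x; rewrite !comp_lfunE; apply/eqP; rewrite -subr_eq0 -linearB.
    apply/eqP/w1ker; rewrite linearB /= limg_lfunVK ?subrr // memv_img ?memvf //.
  have F1 : (phi x1, (w1 \o phi^-1)%VF) \in forward_space L.
    by apply/mem_forward_space; exists x1; rewrite ?w1E.
  have /pairing_eq0 /= := orthp _ F1.
  by rewrite fE /= -[in X in _ -> _ + X = _]w1E !comp_lfunE.
case/memv_addP=> -[x w] Lx [_ /memv_imgP[k kerk ->]]; rewrite inlE => -[-> e].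
have phik : phi k = 0 by apply/eqP; rewrite -memv_ker.
apply/mem_forward_space; exists x; first by rewrite linearD /= phik addr0.
by rewrite e /= addr0.
Qed.

Definition forward (L : Dir V) : Dir W := MkDir (forward_max_isotropic L).
End Forward.

(* Main.v *)
Require Import Defs.
From mathcomp Require Import all_boot all_order all_algebra.
From mathcomp Require Import reals.

(** The shear by [phi^* B] and the shear by [B] correspond under [phi]: since
    [(phi^* B)(x, .) = phi^* (B(phi x, .))], the condition
    [(x, phi^* eta) \in tau_(phi^* B) L] says exactly that
    [(x, phi^* (eta - B(phi x, .))) \in L].  Hence both sides of the equality
    consist of the pairs [(phi x, zeta + B(phi x, .))] with
    [(x, phi^* zeta) \in L]. *)

Lemma flat_pullback (R : realType) (V W : vectType R) (phi : 'Hom(V, W))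
  (B : Bil W) (x : V) :
  flat (pullback phi B) x = (flat B (phi x) \o phi)%VF.
Proof. by apply/lfunP => z; rewrite comp_lfunE !flatE pullbackE. Qed.

Theorem lemma2p11 (R : realType) (V W : vectType R) (phi : 'Hom(V, W))
  (B : Bil W) (L : Dir V) :
  forward phi (gauge (pullback phi B) L) = gauge B (forward phi L).
Proof.
apply: Dir_inj => -[y eta]; apply/idP/idP.
  move=> /mem_forward_space[x -> /mem_gauge_space[w Lw wE]].
  apply/mem_gauge_space; exists (eta - flat B (phi x))%R; last by rewrite GRing.subrK.
  apply/mem_forward_space; exists x => //.
  by rewrite comp_lfunDl comp_lfunNl -flat_pullback wE GRing.addrK.
move=> /mem_gauge_space[zeta /mem_forward_space[x -> Lx] ->].
apply/mem_forward_space; exists x => //.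
apply/mem_gauge_space; exists (zeta \o phi)%VF => //.
by rewrite comp_lfunDl flat_pullback.
Qed.
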